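(* Let $k\ge1$. There is a polynomial function $f(k)$ such that every signed graph $(G,\sigma)$ with $\psi(G,\sigma)=k$ has an induced signed subgraph $(G',\sigma)$ (i.e., $G'$ an induced subgraph of $G$ with the restriction of $\sigma$) with $\psi(G',\sigma)=k$ and $|E(G')|\le f(k)$.
   Context: A signed graph $(G,\sigma)$ is a finite simple graph $G$ with a signature $\sigma:E(G)\to\{-,+\}$. Switching a set $S\subseteq V(G)$ changes the sign of every edge with exactly one end in $S$; two signed graphs on the same underlying graph are equivalent if one is obtained from the other by switching some set of vertices. For $k\ge1$ let $M_k=\{-n,\dots,-1,+1,\dots,+n\}$ if $k=2n$, and $M_k=\{-n,\dots,-1,\pm0,+1,\dots,+n\}$ if $k=2n+1$, where $\pm0$ is a single colour with $-(\pm0)=\pm0$. A $k$-colouring of $(G,\sigma)$ is a map $\phi:V(G)\to M_k$. Let $K_k^*$ be the signed multigraph with vertex set $\{i\ge 0: +i\in M_k\}$ (vertex $0$ standing for colour $\pm0$ when $k$ is odd), in which every two distinct vertices are joined by exactly one positive and one negative edge, and every vertex $i\neq0$ carries exactly one negative loop. Given a $k$-colouring $\phi$, the reduced signed graph $R(G,\sigma,\phi)$ is obtained by (1) switching every vertex with a negative colour $-i$ and recolouring it $+i$; (2) identifying, for each $i$, all vertices of colour $+i$ (resp. $\pm0$) into a single vertex $i$ (resp. $0$), edges inside a class becoming loops; (3) keeping at most one positive and at most one negative edge (or loop) between any two vertices (or at any vertex). The colouring $\phi$ is complete if $R(G,\sigma,\phi)$ is exactly $K_k^*$. The achromatic number $\psi(G,\sigma)$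 is the largest $k\ge1$ such that some signed graph equivalent to $(G,\sigma)$ admits a complete $k$-colouring. *)

(* Defs.v *)
From HB Require Import structures.
From mathcomp Require Import all_boot all_order all_algebra.
Set Implicit Arguments.
Unset Strict Implicit.
Unset Printing Implicit Defensive.

Record sgraph (V : finType) := SGraph {
  adj : rel V;
  adj_sym : symmetric adj;
  adj_irrefl : irreflexive adj
}.

Definition edges (V : finType) (G : sgraph V) : {set {set V}} :=
  [set e | [exists x, exists y, adj G x y && (e == [set x; y])]].

(* Signs are booleans with [true] for -, so that changing a sign is [addb true].
   A signature of [G] is only ever read on [edges G]; its values elsewhere are
   irrelevant. *)
Definition sign := bool.
Definition negative : sign := true.

Definition signature (V : finType) := {set V} -> sign.

Definition switch (V : finType) (S : {set V}) (sigma : signature V) :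
    signature V :=
  fun e => sigma e (+) (#|e :&: S| == 1).

Definition equivalent (V : finType) (G : sgraph V) (sigma tau : signature V) :=
  exists S : {set V}, {in edges G, tau =1 switch S sigma}.

Section Induced.
Variables (V : finType) (G : sgraph V) (A : {set V}).

Definition induced_adj : rel {x : V | x \in A} :=
  fun x y => adj G (val x) (val y).

Lemma induced_adj_sym : symmetric induced_adj.
Proof. by move=> x y; exact: adj_sym. Qed.

Lemma induced_adj_irrefl : irreflexive induced_adj.
Proof. by move=> x; exact: adj_irrefl. Qed.

Definition induced : sgraph {x : V | x \in A} :=
  SGraph induced_adj_sym induced_adj_irrefl.

Definition restrict (sigma : signature V) : signature {x : V | x \in A} :=
  fun e => sigma [set val x | x in e].

End Induced.

(* The colours M_k are integers: the single colour written +-0 is 0, and it is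
   available exactly when k is odd. *)
Definition colours (k : nat) : pred int :=
  fun c => (absz c <= k./2) && (odd k || (c != 0%R)).

Definition colouring (V : finType) (k : nat) (phi : V -> int) :=
  forall x, phi x \in colours k.

(* Signed multigraphs with vertices in nat. [mult s i j] is the number of edges
   of sign [s] joining [i] and [j], or of loops of sign [s] at [i] if [i = j]. *)
Record smgraph := SMGraph {
  mvert : pred nat;
  mult : sign -> nat -> nat -> nat
}.

Definition same_smgraph (H K : smgraph) :=
  mvert H =1 mvert K /\ forall s i j, mult H s i j = mult K s i j.

Definition Kstar (k : nat) : smgraph :=
  let vert i := Posz i \in colours k in
  SMGraph vert (fun s i j =>
    if vert i && vert j then
      if i == j then nat_of_bool ((i != 0) && (s == negative)) else 1
    else 0).

(* Identifies the vertices of equal class [c]; every edge of [G] is kept, as a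
   loop when its two ends have the same class. *)
Definition identify (V : finType) (G : sgraph V) (sigma : signature V)
    (c : V -> nat) : smgraph :=
  SMGraph (fun i => [exists x, c x == i]) (fun s i j =>
    #|[set e in edges G | (sigma e == s) &&
        [exists x, exists y,
          [&& e == [set x; y], x != y, c x == i & c y == j]]]|).

Definition simplify (H : smgraph) : smgraph :=
  SMGraph (mvert H) (fun s i j => minn (mult H s i j) 1).

Definition reduced (V : finType) (G : sgraph V) (sigma : signature V)
    (phi : V -> int) : smgraph :=
  let sigma1 := switch [set x | (phi x < 0)%R] sigma in
  simplify (identify G sigma1 (fun x => absz (phi x))).

Definition complete_colouring (V : finType) (G : sgraph V)
    (sigma : signature V) (k : nat) (phi : V -> int) :=
  colouring k phi /\ same_smgraph (reduced G sigma phi) (Kstar k).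

Definition admits_complete (V : finType) (G : sgraph V) (sigma : signature V)
    (k : nat) :=
  exists tau, equivalent G sigma tau /\
    exists phi : V -> int, complete_colouring G tau k phi.

(* [achromatic G sigma k] is psi(G, sigma) = k. A relation rather than a
   function, because the graph with no vertex has no complete k-colouring with
   k >= 1 and hence no achromatic number. *)
Definition achromatic (V : finType) (G : sgraph V) (sigma : signature V)
    (k : nat) :=
  [/\ 1 <= k, admits_complete G sigma k
    & forall m, 1 <= m -> admits_complete G sigma m -> m <= k].

(* Main.v *)
Require Import Defs.
From mathcomp Require Import all_boot all_order all_algebra.
From mathcomp Require Import zify.

Set Implicit Arguments.
Unset Strict Implicit.
Unset Printing Implicit Defensive.

(** Keeping the ends of one edge of [G] for each edge of [K_k^*] gives a vertex
    set [A] of size O(k^2) on which the colouring is still complete, so it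
    remains to see that [psi] cannot be larger on an induced subgraph.  Add
    the missing vertices one at a time to a complete m-colouring.  If a new
    vertex [v] fits in no class, with either sign, then it sees both signs in
    every nonzero class, and it sees the class 0 when there is one.  If [m] is
    even, [v] alone forms a class 0.  If [m] is odd, [v] joins the independent
    class 0, whose vertices are switched so that their edges to [v] become
    negative, and together they form a new nonzero class.  Either way one gets
    a complete (m+1)-colouring. *)

(** * Vertices and edges of [K_m^*] as boolean predicates *)

Definition mcolour (m i : nat) : bool := (i <= m./2) && (odd m || (i != 0)).

(** All multiplicities in [K_m^*] are 0 or 1, so a boolean suffices. As [true] is the negative sign,
    the last conjunct leaves only negative loops, at nonzero vertices. *)
Definition Kedge (m : nat) (s : sign) (i j : nat) : bool :=
  [&& mcolour m i, mcolour m j & (i == j) ==> (i != 0) && s].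

(** Parity governs the passage to [m.+1]: for odd [m] the colour 0 disappears and [m./2.+1] appears,
    for even [m] only 0 appears. *)
Lemma mcolourS_odd m i : odd m ->
  mcolour m.+1 i -> i != m./2.+1 -> mcolour m i /\ i != 0.
Proof. rewrite /mcolour; lia. Qed.

Lemma mcolourS_even m i : ~~ odd m ->
  mcolour m.+1 i -> i != 0 -> mcolour m i.
Proof. rewrite /mcolour; lia. Qed.

Lemma mult_Kstar m s i j : mult (Kstar m) s i j = Kedge m s i j.
Proof.
rewrite /Kedge /= -![_ \in colours m]/(mcolour m _).
case: (mcolour m i) => [|//]; case: (mcolour m j) => [|//].
by case: (i == j); case: s; rewrite ?andbT ?andbF.
Qed.

(** * Signed graphs up to switching, and their complete colourings *)

Section SignedGraph.
Variables (V : finType) (G : sgraph V) (sigma : signature V).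
Implicit Types (A S T : {set V}) (x y : V).

(** Agrees with [switch T sigma] on pairs of distinct vertices, hence on every edge, without the
    cardinality of an intersection. *)
Definition switched_sign T x y : sign :=
  sigma [set x; y] (+) (x \in T) (+) (y \in T).

Lemma switched_signC T x y : switched_sign T x y = switched_sign T y x.
Proof. by rewrite /switched_sign setUC -!addbA [(x \in T) (+) _]addbC. Qed.

Lemma adj_neq x y : adj G x y -> x != y.
Proof. by apply: contraTneq => ->; rewrite adj_irrefl. Qed.

Lemma mem_edges x y : ([set x; y] \in edges G) = adj G x y.
Proof.
rewrite inE; apply/existsP/idP => [[a /existsP[b /andP[ab /eqP e]]]|xy].
  have := set21 a b; have := set22 a b; rewrite -e !inE.
  case/orP => /eqP eb; case/orP => /eqP ea; subst; rewrite ?adj_irrefl // in ab.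
  by rewrite adj_sym.
by exists x; apply/existsP; exists y; rewrite xy eqxx.
Qed.

Lemma switch_set2 S tau x y : x != y ->
  switch S tau [set x; y] = tau [set x; y] (+) (x \in S) (+) (y \in S).
Proof.
move=> nxy; rewrite /switch -addbA; congr (_ (+) _).
rewrite setIUl cardsU.
have cap1 z : [set z] :&: S = if z \in S then [set z] else set0.
  by apply/setP=> t; case: ifP => zS; rewrite !inE;
     have [->|] := eqVneq t z; rewrite ?zS.
rewrite !cap1; case: (x \in S); case: (y \in S);
  rewrite ?setI0 ?set0I ?cards0 ?cards1 //.
by rewrite disjoint_setI0 ?cards0 // disjoints1 inE.
Qed.

Lemma switch_switch S T x y : x != y ->
  switch T (switch S sigma) [set x; y] =
  switched_sign [set z | (z \in S) (+) (z \in T)] x y.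
Proof.
move=> nxy; rewrite !switch_set2 // /switched_sign !inE.
by case: (sigma _); do 4 case: (_ \in _).
Qed.

(** Capping multiplicities at 1 turns counting edges into the existence of one. *)
Lemma mult_reduced tau (phi : V -> int) s i j :
  mult (reduced G tau phi) s i j =
  [exists x, exists y,
     [&& adj G x y, switch [set x | (phi x < 0)%R] tau [set x; y] == s,
         absz (phi x) == i & absz (phi y) == j]].
Proof.
rewrite /=; set B := [set e in _ | _].
have -> : minn #|B| 1 = (B != set0) by rewrite -card_gt0; case: #|B| => [|[]].
congr nat_of_bool; apply/set0Pn/existsP.
- move=> [e]; rewrite inE => /and3P[eG es /existsP[x /existsP[y]]].
  case/and4P => /eqP ee nxy ci cj; subst e; exists x; apply/existsP; exists y.
  by rewrite -mem_edges eG es ci.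
- move=> [x /existsP[y /and4P[xy es ci cj]]]; exists [set x; y].
  rewrite inE mem_edges xy es /=; apply/existsP; exists x; apply/existsP.
  by exists y; rewrite eqxx (adj_neq xy) ci.
Qed.

(* A switching set [T] together with the absolute values [c] of the colours
   encodes an equivalent signed graph together with a colouring of it: the
   final signs depend only on [T], the symmetric difference of the set switched
   for the equivalence and of the set of negatively coloured vertices. *)
Definition complete_on A T (c : V -> nat) (m : nat) :=
  [/\ {in A, forall x, mcolour m (c x)},
      {in A &, forall x y, adj G x y -> c x = c y ->
         c x != 0 /\ switched_sign T x y},
      forall i, mcolour m i -> exists2 x, x \in A & c x = i
    & forall s i j, Kedge m s i j ->
        exists x y, [/\ x \in A /\ y \in A, adj G x y, c x = i, c y = j
                      & switched_sign T x y = s]].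

Lemma admits_completeP m :
  admits_complete G sigma m <-> exists T c, complete_on setT T c m.
Proof.
split=> [[tau [[S tauE] [phi [phiP [vertE multE]]]]]|].
- have signE x y : adj G x y ->
      switch [set x | (phi x < 0)%R] tau [set x; y] =
      switched_sign [set z | (z \in S) (+) (z \in [set x | (phi x < 0)%R])] x y.
    move=> xy; rewrite -switch_switch ?(adj_neq xy) //.
    by rewrite /switch tauE // mem_edges.
  exists [set z | (z \in S) (+) (z \in [set x | (phi x < 0)%R])].
  exists (fun x => absz (phi x)); split.
  + by move=> x _; have := phiP x; rewrite /mcolour unfold_in absz_eq0.
  + move=> x y _ _ xy cxy.
    (* The edge becomes a loop at its class, and [Kstar] only has negative loops at nonzero
       vertices. *)
    have := multE (switched_sign [set z | (z \in S) (+)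
      (z \in [set x | (phi x < 0)%R])] x y) (absz (phi x)) (absz (phi x)).
    rewrite mult_reduced mult_Kstar; set b := [exists x0, _].
    have -> : b.
      apply/existsP; exists x; apply/existsP; exists y.
      by rewrite xy signE // cxy !eqxx.
    by rewrite /Kedge eqxx; case/esym/eqP; rewrite eqb1 => /and4P[_ _ -> ->].
  + move=> i im; have := vertE i; rewrite /= => ei.
    have : [exists x, absz (phi x) == i] by rewrite ei.
    by case/existsP=> x /eqP; exists x.
  + move=> s i j e; have := multE s i j.
    rewrite mult_reduced mult_Kstar e => /eqP; rewrite eqb1.
    case/existsP=> x /existsP[y /and4P[xy /eqP es /eqP ci /eqP cj]].
    by exists x, y; split=> //; rewrite -signE.
case=> T [c [cP proper surj full]].
exists (switch T sigma); split; first by exists T.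
(* With nonnegative colours the reduction switches nothing, so the signs come from [T] alone. *)
exists (fun x => Posz (c x)); split; first by move=> x; exact: cP.
have signE x y : adj G x y ->
    switch [set x | (Posz (c x) < 0)%R] (switch T sigma) [set x; y] =
    switched_sign T x y.
  move=> xy; rewrite switch_switch ?(adj_neq xy) //; congr switched_sign.
  by apply/setP=> z; rewrite !inE addbF.
split=> [i|s i j].
  apply/existsP/idP => [[x /eqP <-]|im]; first exact: cP.
  by have [x _ cx] := surj i im; exists x; rewrite /= cx.
rewrite mult_reduced mult_Kstar; congr nat_of_bool; apply/existsP/idP.
- case=> x /existsP[y /and4P[xy /eqP es /eqP ci /eqP cj]].
  rewrite /= in ci cj; rewrite /Kedge -{1}ci -{1}cj !cP ?inE //=.
  apply/implyP=> /eqP eij.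
  have [] := proper x y (in_setT x) (in_setT y) xy; first by rewrite ci cj.
  by rewrite ci -signE // es => -> ->.
- case/full=> x [y [_ xy ci cj es]]; exists x; apply/existsP; exists y.
  by rewrite xy signE // es /= ci cj !eqxx.
Qed.

(** * Extending a complete colouring to further vertices *)

Lemma complete_on_add_vertex A T c m v : v \notin A -> complete_on A T c m ->
  exists T' c' m', m <= m' /\ complete_on (v |: A) T' c' m'.
Proof.
move=> vA [cP proper surj full].
have neqv x : x \in A -> x != v by apply: contraTneq => ->.
(* Here [b] tells whether [v] is switched: [v] may join class [i] if this creates only negative
   loops, and none at 0. *)
pose fits (i : 'I_(m./2.+1)) (b : bool) := mcolour m i &&
  [forall x in A, adj G v x && (c x == i) ==>
     (nat_of_ord i != 0) && (sigma [set v; x] (+) b (+) (x \in T))].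
have [/existsP[i /existsP[b /andP[im /forall_inP fit]]]|nofit] :=
    boolP [exists i, exists b, fits i b].
  (* Nothing changes on [A], so all witnesses of completeness survive. *)
  pose T' := [set x | if x == v then b else x \in T].
  pose c' x := if x == v then nat_of_ord i else c x.
  have c'A x : x \in A -> c' x = c x by move/neqv; rewrite /c' => /negPf->.
  have T'A x : x \in A -> (x \in T') = (x \in T).
    by move/neqv; rewrite inE => /negPf->.
  have sA x y : x \in A -> y \in A -> switched_sign T' x y = switched_sign T x y.
    by move=> xA yA; rewrite /switched_sign !T'A.
  have properv x : x \in A -> adj G v x -> c' v = c' x ->
      c' v != 0 /\ switched_sign T' v x.
    move=> xA vx; rewrite (c'A x) // /c' eqxx => e.
    have /implyP := fit x xA; rewrite vx e eqxx => /(_ isT)/andP[ci si].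
    by split; rewrite ?e // /switched_sign (T'A x) // inE eqxx.
  exists T', c', m; split=> //; split.
  + move=> x /setU1P[->|xA]; first by rewrite /c' eqxx.
    by rewrite c'A ?cP.
  + move=> x y /setU1P[->|xA] /setU1P[->|yA] xy e.
    * by rewrite adj_irrefl in xy.
    * exact: properv.
    * by rewrite e switched_signC; apply: properv; rewrite // adj_sym.
    * by move: e; rewrite !c'A // sA //; apply: proper.
  + move=> j /surj[x xA cx]; exists x; rewrite ?c'A //.
    by rewrite inE xA orbT.
  + move=> s j1 j2 /full[x [y [[xA yA] xy c1 c2 es]]]; exists x, y.
    by rewrite !c'A // sA // !inE xA yA !orbT.
(* A misfit for [b] is a neighbour whose edge would be positive, so its sign with [v] unswitched is
   [b]. In class 0 any neighbour is a misfit, whence no information on the sign. *)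
have nofitP i b : mcolour m i ->
    exists2 x, x \in A & [/\ adj G v x, c x = i &
      i != 0 -> sigma [set v; x] (+) (x \in T) = b].
  move=> im; have ilt : i < m./2.+1 by case/andP: im.
  move: nofit; rewrite negb_exists => /forallP/(_ (Ordinal ilt)).
  rewrite negb_exists => /forallP/(_ b); rewrite /fits /= im /=.
  rewrite negb_forall_in => /exists_inP[x xA].
  rewrite negb_imply => /andP[/andP[vx /eqP ci] ns].
  exists x => //; split=> // i0; move: ns; rewrite i0 /=.
  by case: (sigma _); case: b; case: (_ \in _).
have [mo|me] := boolP (odd m); last first.
  (* [T] may contain [v]; removing it makes the signs at [v] those of [nofitP]. *)
  pose T' := T :\ v.
  pose c' x := if x == v then 0 else c x.
  have c'A x : x \in A -> c' x = c x by move/neqv; rewrite /c' => /negPf->.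
  have cv : c' v = 0 by rewrite /c' eqxx.
  have c0 x : x \in A -> c x != 0.
    by move/cP; rewrite /mcolour (negPf me) => /andP[].
  have T'A x : x \in A -> (x \in T') = (x \in T).
    by move/neqv; rewrite !inE => ->.
  have sA x y : x \in A -> y \in A -> switched_sign T' x y = switched_sign T x y.
    by move=> xA yA; rewrite /switched_sign !T'A.
  have edgev s i : mcolour m.+1 i -> i != 0 -> exists2 x, x \in A &
      [/\ adj G v x, c' x = i & switched_sign T' v x = s].
    move=> im i0; have [x xA [vx ci es]] := nofitP i s (mcolourS_even me im i0).
    exists x => //; rewrite c'A //; split=> //.
    by rewrite /switched_sign (T'A x) // !inE eqxx /= addbF es.
  exists T', c', m.+1; split=> //; split.
  + move=> x /setU1P[->|xA]; first by rewrite cv /mcolour /= me.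
    by rewrite c'A //; have := cP x xA; rewrite /mcolour; lia.
  + move=> x y /setU1P[->|xA] /setU1P[->|yA] xy.
    * by rewrite adj_irrefl in xy.
    * by rewrite cv c'A // => e; have := c0 _ yA; rewrite -e.
    * by rewrite cv c'A // => e; have := c0 _ xA; rewrite e.
    * by rewrite !c'A // sA //; apply: proper.
  + move=> i im; have [->|i0] := eqVneq i 0; first by exists v; rewrite ?setU11.
    have [x xA cx] := surj i (mcolourS_even me im i0).
    by exists x; rewrite ?c'A // inE xA orbT.
  + move=> s i j /and3P[im jm /implyP ij].
    have [i0|i0] := eqVneq i 0.
      have j0 : j != 0 by apply/eqP=> j0; move: ij; rewrite i0 j0 => /(_ isT).
      have [x xA [vx cj es]] := edgev s j jm j0.
      by exists v, x; rewrite setU11 inE xA orbT cv i0.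
    have [j0|j0] := eqVneq j 0.
      have [x xA [vx ci es]] := edgev s i im i0.
      by exists x, v; rewrite setU11 inE xA orbT cv j0 adj_sym switched_signC.
    have [|x [y [[xA yA] xy ci cj es]]] := full s i j.
      apply/and3P; split; [exact: mcolourS_even im i0 | | exact/implyP].
      exact: mcolourS_even jm j0.
    by exists x, y; rewrite !c'A // sA // !inE xA yA !orbT.
have m0 : mcolour m 0 by rewrite /mcolour mo.
pose n := m./2.
(* With [v] unswitched, exactly the class 0 vertices with a positive pair to [v] are switched. This
   may spoil their edges to other classes, but [v] alone supplies both signs there. *)
pose T' := [set x | (x != v) &&
  if c x == 0 then ~~ sigma [set v; x] else x \in T].
pose c' x := if (x == v) || (c x == 0) then n.+1 else c x.
have cv : c' v = n.+1 by rewrite /c' eqxx.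
have cn x : x \in A -> (c x == n.+1) = false.
  by move/cP; rewrite /mcolour /n; lia.
have c'A x : x \in A -> c x != 0 -> c' x = c x.
  by move/neqv; rewrite /c' => /negPf-> /negPf->.
have c'0 x : c x = 0 -> c' x = n.+1 by rewrite /c' => ->; rewrite orbT.
have T'A x : x \in A -> c x != 0 -> (x \in T') = (x \in T).
  by move/neqv; rewrite inE => -> /negPf->.
have sA x y : x \in A -> y \in A -> c x != 0 -> c y != 0 ->
    switched_sign T' x y = switched_sign T x y.
  by move=> *; rewrite /switched_sign !T'A.
have sv0 x : x \in A -> c x = 0 -> switched_sign T' v x.
  move=> xA cx; rewrite /switched_sign !inE eqxx (neqv x xA) cx /= addbF.
  by case: (sigma _).
have edgev s i : mcolour m i -> i != 0 -> exists2 x, x \in A &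
    [/\ adj G v x, c' x = i & switched_sign T' v x = s].
  move=> im i0; have [x xA [vx ci es]] := nofitP i s im.
  exists x => //; rewrite c'A ?ci //; split=> //.
  by rewrite /switched_sign (T'A x) ?ci // inE eqxx /= addbF es.
have Sm i : mcolour m i -> i != 0 -> mcolour m.+1 i.
  by rewrite /mcolour; lia.
have properv x : x \in A -> adj G v x -> c' v = c' x ->
    c' v != 0 /\ switched_sign T' v x.
  move=> xA vx; rewrite cv; have [cx _|cx] := eqVneq (c x) 0.
    by rewrite sv0.
  by rewrite c'A // => /esym/eqP; rewrite cn.
exists T', c', m.+1; split=> //; split.
- have mn : mcolour m.+1 n.+1 by rewrite /mcolour /n; lia.
  move=> x /setU1P[->|xA]; first by rewrite cv.
  have [cx|cx] := eqVneq (c x) 0; first by rewrite c'0.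
  by rewrite c'A //; apply: Sm; rewrite ?cP.
- move=> x y /setU1P[->|xA] /setU1P[->|yA] xy e.
  + by rewrite adj_irrefl in xy.
  + exact: properv.
  + by rewrite e switched_signC; apply: properv; rewrite // adj_sym.
  + have [cx|cx] := eqVneq (c x) 0; have [cy|cy] := eqVneq (c y) 0.
    (* Class 0 is independent, so its new switching creates no positive loop. *)
    * by have [] := proper x y xA yA xy; rewrite cx.
    * by move: e; rewrite c'0 // c'A // => /esym/eqP; rewrite cn.
    * by move: e; rewrite (c'0 y) // c'A // => /eqP; rewrite cn.
    * by move: e; rewrite !c'A // sA //; apply: proper.
- move=> i im; have [->|ni] := eqVneq i n.+1; first by exists v; rewrite ?setU11.
  have [im' i0] := mcolourS_odd mo im ni.
  have [x xA cx] := surj i im'.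
  by exists x; rewrite ?c'A ?cx // inE xA orbT.
- move=> s i j /and3P[im jm /implyP ij].
  have [ein|nin] := eqVneq i n.+1; have [ejn|njn] := eqVneq j n.+1.
  (* The required negative loop comes from an edge between [v] and the old class 0. *)
  + have [x xA [vx cx _]] := nofitP 0 s m0.
    exists v, x; rewrite setU11 inE xA orbT cv c'0 // sv0 // ein ejn; split=> //.
    by have := ij; rewrite ein ejn eqxx => /(_ isT); case: (s).
  + have [jm' j0] := mcolourS_odd mo jm njn.
    have [x xA [vx cj es]] := edgev s j jm' j0.
    by exists v, x; rewrite setU11 inE xA orbT cv ein.
  + have [im' i0] := mcolourS_odd mo im nin.
    have [x xA [vx ci es]] := edgev s i im' i0.
    by exists x, v; rewrite setU11 inE xA orbT cv ejn adj_sym switched_signC.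
  + have [im' i0] := mcolourS_odd mo im nin.
    have [jm' j0] := mcolourS_odd mo jm njn.
    have [|x [y [[xA yA] xy ci cj es]]] := full s i j.
      by rewrite /Kedge im' jm'; apply/implyP.
    by exists x, y; rewrite !c'A ?sA ?ci ?cj // !inE xA yA !orbT.
Qed.

(** Induction on the number of missing vertices. This is what bounds the achromatic number of an
    induced subgraph by that of [G]. *)
Lemma complete_on_extend A T c m : complete_on A T c m ->
  exists T' c' m', m <= m' /\ complete_on setT T' c' m'.
Proof.
have [n] := ubnP #|~: A|; elim: n => // n IHn in A T c m *.
rewrite ltnS => le_n cA; have [A0|[v]] := set_0Vmem (~: A).
  by exists T, c, m; split=> //; rewrite -setC0 -A0 setCK.
rewrite inE => vA.
have [T1 [c1 [m1 [mm1 c1A]]]] := complete_on_add_vertex vA cA.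
have [|T2 [c2 [m2 [m12 c2A]]]] := IHn _ _ _ _ _ c1A.
  apply: leq_trans le_n; rewrite setCU setIC -setDE.
  by rewrite [in ltnRHS](cardsD1 v) inE vA.
by exists T2, c2, m2; split=> //; apply: leq_trans m12.
Qed.

(** * Small vertex sets that keep the colouring complete *)

Lemma complete_on_subset T c m : complete_on setT T c m ->
  exists2 A : {set V}, #|A| <= 6 * m.+1 ^ 2 & complete_on A T c m.
Proof.
move=> [cP proper surj full].
(* Properness passes to subsets, so only witnesses must be kept: for each sign and pair of colours,
   one vertex of the first colour and two ends of an edge. *)
pose I : finType := (bool * 'I_(m./2.+1) * 'I_(m./2.+1))%type.
have wit (t : I) : exists W : {set V}, [/\ #|W| <= 3,
    mcolour m t.1.2 -> exists2 x, x \in W & c x = t.1.2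
  & Kedge m t.1.1 t.1.2 t.2 ->
      exists x y, [/\ x \in W /\ y \in W, adj G x y, c x = t.1.2, c y = t.2
                    & switched_sign T x y = t.1.1]].
  case: t => [[s i] j] /=.
  have [Wv [W1 Pv]] : exists Wv : {set V}, #|Wv| <= 1 /\
      (mcolour m i -> exists2 x, x \in Wv & c x = i).
    case im: (mcolour m i); last by exists set0; rewrite cards0.
    have [x _ cx] := surj i im; exists [set x]; rewrite cards1; split=> // _.
    by exists x; rewrite ?set11.
  have [We [W2 Pe]] : exists We : {set V}, #|We| <= 2 /\ (Kedge m s i j ->
      exists x y, [/\ x \in We /\ y \in We, adj G x y, c x = i, c y = j
                    & switched_sign T x y = s]).
    case e: (Kedge m s i j); last by exists set0; rewrite cards0.
    have [x [y [_ xy ci cj es]]] := full _ _ _ e.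
    exists [set x; y]; rewrite cards2 (adj_neq xy); split=> // _.
    by exists x, y; rewrite set21 set22.
  exists (Wv :|: We); split.
  - by rewrite (leq_trans (leq_card_setU _ _)) // (leq_add W1 W2).
  - by case/Pv=> x xW cx; exists x; rewrite // inE xW.
  - case/Pe=> x [y [[xW yW] xy ci cj es]]; exists x, y.
    by rewrite !inE xW yW !orbT.
have [W WP] := fin_all_exists wit.
have subW t x : x \in W t -> x \in \bigcup_t W t.
  by move=> xW; apply/bigcupP; exists t.
exists (\bigcup_t W t).
  apply: (@leq_trans (\sum_(t : I) 3)).
    elim/big_rec2: _ => [|t B k _ le_k]; first by rewrite cards0.
    rewrite (leq_trans (leq_card_setU _ _)) // leq_add //.
    by case: (WP t).
  (* There are [2 * (m./2.+1) ^ 2] triples, with at most 3 vertices each. *)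
  rewrite sum_nat_const !card_prod card_bool !card_ord.
  have le_m : m./2.+1 <= m.+1 by lia.
  by have := leq_mul le_m le_m; rewrite -mulnn; lia.
split.
- by move=> x _; apply: cP; rewrite inE.
- by move=> x y _ _; apply: proper; rewrite inE.
- move=> i im; have ilt : i < m./2.+1 by case/andP: im.
  have [_ /(_ im)[x xW cx] _] := WP (true, Ordinal ilt, Ordinal ilt).
  by exists x; rewrite ?(subW _ _ xW).
- move=> s i j e; have [im jm _] := and3P e.
  have ilt : i < m./2.+1 by case/andP: im.
  have jlt : j < m./2.+1 by case/andP: jm.
  have [_ _ /(_ e)[x [y [[xW yW] *]]]] := WP (s, Ordinal ilt, Ordinal jlt).
  by exists x, y; rewrite (subW _ _ xW) (subW _ _ yW).
Qed.

Lemma card_edges_leq : #|edges G| <= #|V| ^ 2.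
Proof.
rewrite -mulnn -card_prod -cardsT.
apply: leq_trans (leq_imset_card (fun p : V * V => [set p.1; p.2]) _).
apply/subset_leq_card/subsetP=> e.
rewrite inE => /existsP[x /existsP[y /andP[_ /eqP->]]].
by apply/imsetP; exists (x, y).
Qed.

End SignedGraph.

(** * Transfer to the induced subgraph *)

Section InducedSubgraph.
Variables (V : finType) (G : sgraph V) (sigma : signature V) (A : {set V}).
Let U := {x : V | x \in A}.

Lemma restrict_set2 (x y : U) :
  restrict (A := A) sigma [set x; y] = sigma [set val x; val y].
Proof. by rewrite /restrict imsetU1 imset_set1. Qed.

(** Only the agreement of both encodings along [val] is assumed, so that either one can be built
    from the other. *)
Lemma induced_complete_onE (T : {set V}) c (T' : {set U}) (c' : U -> nat) m :
  (forall x : U, (x \in T') = (val x \in T)) -> c' =1 c \o val ->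
  complete_on G sigma A T c m <->
  complete_on (induced G A) (restrict (A := A) sigma) setT T' c' m.
Proof.
move=> TE cE.
have signE x y : switched_sign (restrict (A := A) sigma) T' x y =
                 switched_sign sigma T (val x) (val y).
  by rewrite /switched_sign restrict_set2 !TE.
split=> -[cP proper surj full]; split.
- by move=> x _; rewrite cE cP ?(valP x).
- by move=> x y _ _; rewrite !cE signE; apply: proper; apply: valP.
- by move=> i /surj[x xA cx]; exists (Sub x xA : U); rewrite ?cE ?inE.
- move=> s i j /full[x [y [[xA yA] xy ci cj es]]].
  by exists (Sub x xA : U), (Sub y yA : U); rewrite !cE signE !inE.
- by move=> x xA; have := cP (Sub x xA : U); rewrite cE inE; apply.
- move=> x y xA yA; have := proper (Sub x xA : U) (Sub y yA : U).
  by rewrite !cE signE !inE; apply.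
- by move=> i /surj[x _ cx]; exists (val x); rewrite ?(valP x) // -cx cE.
- move=> s i j /full[x [y [_ xy ci cj es]]]; exists (val x), (val y).
  by rewrite (valP x) (valP y) -signE -ci -cj !cE.
Qed.

Lemma admits_complete_inducedP m :
  admits_complete (induced G A) (restrict (A := A) sigma) m <->
  exists T c, complete_on G sigma A T c m.
Proof.
split=> [/admits_completeP[T [c cT]]|[T [c cA]]].
  (* The default colour 0 is only taken outside [A], where [complete_on] never reads it. *)
  exists [set val x | x in T], (fun v => oapp c 0 (insub v)).
  apply: (proj2 (induced_complete_onE _ _ _)) cT => x; last by rewrite /= valK.
  by rewrite (mem_imset _ _ val_inj).
apply/admits_completeP; exists [set x | val x \in T], (c \o val).
by apply: (proj1 (induced_complete_onE _ _ _)) cA => x; rewrite ?inE.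
Qed.

End InducedSubgraph.

(** * The polynomial bound *)

Import Order.TTheory.

Theorem theorem4p1 :
  exists f : {poly int}, forall k : nat, 1 <= k ->
    forall (V : finType) (G : sgraph V) (sigma : signature V),
      achromatic G sigma k ->
      exists A : {set V},
        achromatic (induced G A) (restrict (A := A) sigma) k /\
        (Posz #|edges (induced G A)| <= f.[Posz k])%R.
Proof.
(* This is the square of [6 * k.+1 ^ 2], the bound on the number of vertices kept. *)
exists (36%:R *: ('X + 1) ^+ 4)%R => k k1 V G sigma.
case=> _ /admits_completeP[T [c cT]] kmax.
have [A leA cA] := complete_on_subset cT; exists A; split.
  split=> //; first by apply/admits_complete_inducedP; exists T, c.
  (* An [m]-colouring on [A] extends to an [m']-colouring of [G] with [m <= m'], and [m' <= k] by
     maximality. *)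
  move=> m m1 /admits_complete_inducedP[T1 [c1 /complete_on_extend]].
  case=> T2 [c2 [m' [mm' c2T]]]; apply: leq_trans (mm') _.
  apply: kmax; first exact: leq_trans mm'.
  by apply/admits_completeP; exists T2, c2.
have le1 : #|edges (induced G A)| <= #|A| ^ 2.
  by rewrite (leq_trans (card_edges_leq _)) // card_sig.
have le2 : #|A| ^ 2 <= (6 * k.+1 ^ 2) ^ 2 by rewrite leq_sqr.
rewrite hornerZ horner_exp hornerD hornerX hornerC.
apply: (@le_trans _ _ (Posz ((6 * k.+1 ^ 2) ^ 2))); last by lia.
by rewrite lez_nat (leq_trans le1).
Qed.
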